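(* Let $\mathcal G$ be a groupoid over a non-empty set $\mathcal P$. There is a bijective correspondence between (a) structures of braided groupoid $(\mathcal G,\sigma)$ on $\mathcal G$, and (b) 1-cocycle groupoid data $(\mathcal G,\mathcal N,\pi)$ (up to isomorphism). In this correspondence, $\mathcal G\bowtie\mathcal G\simeq\mathcal G\ltimes\mathcal N$ as groupoids, and $$\sigma(f,g)=\Bigl(fg\,\bigl(\pi^{-1}(\pi(f)\leftharpoonup g)\bigr)^{-1},\ \pi^{-1}(\pi(f)\leftharpoonup g)\Bigr),\qquad f,g\in\mathcal G,\ \mathfrak e(f)=\mathfrak s(g).$$
   Context: Groupoids over $\mathcal P$ have source and end maps $\mathfrak s,\mathfrak e:\mathcal G\to\mathcal P$, and $fg$ is defined when $\mathfrak e(f)=\mathfrak s(g)$; $\mathcal G\,{}_{\mathfrak e}\times_{\mathfrak s}\mathcal G$ is the set of composable pairs. A left action of $\mathcal G$ on a map $p:\mathcal E\to\mathcal P$ assigns $g\rightharpoonup e$ to $(g,e)$ with $\mathfrak e(g)=p(e)$, with $p(g\rightharpoonup e)=\mathfrak s(g)$, $g\rightharpoonup(h\rightharpoonup e)=gh\rightharpoonup e$, $\mathrm{id}\rightharpoonup e=e$. A right action assigns $e\leftharpoonup g$ to $(e,g)$ with $p(e)=\mathfrak s(g)$, with $p(e\leftharpoonup g)=\mathfrak e(g)$, $(e\leftharpoonup g)\leftharpoonup h=e\leftharpoonup gh$, $e\leftharpoonup\mathrm{id}=e$. A braided groupoid is a groupoid $\mathcal G$ with a left action $\rightharpoonup$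 of $\mathcal G$ on $\mathfrak s:\mathcal G\to\mathcal P$ and a right action $\leftharpoonup$ of $\mathcal G$ on $\mathfrak e:\mathcal G\to\mathcal P$ such that $\mathfrak e(x\rightharpoonup g)=\mathfrak s(x\leftharpoonup g)$, $x\rightharpoonup fg=(x\rightharpoonup f)((x\leftharpoonup f)\rightharpoonup g)$, $xy\leftharpoonup g=(x\leftharpoonup(y\rightharpoonup g))(y\leftharpoonup g)$, and $fg=(f\rightharpoonup g)(f\leftharpoonup g)$ whenever defined. The structure is recorded by $\sigma(f,g)=(f\rightharpoonup g,f\leftharpoonup g)$. The groupoid $\mathcal G\bowtie\mathcal G$ is the set of composable pairs with product $(f,y)(h,z)=(f(y\rightharpoonup h),(y\leftharpoonup h)z)$, source $\mathfrak s(f)$ and end $\mathfrak e(y)$ for $(f,y)$. A group bundle over $\mathcal P$ is a groupoid $\mathcal N$ whose source and end maps coincide (denoted $p$). A right action of $\mathcal G$ on $p:\mathcal N\to\mathcal P$ is by group bundle automorphisms if $xy\leftharpoonup g=(x\leftharpoonup g)(y\leftharpoonup g)$. The semidirect product $\mathcal G\ltimes\mathcal N$ is $\{(g,n):\mathfrak e(g)=p(n)\}$ with product $(g,m)(h,n)=(gh,(m\leftharpoonup h)n)$. A 1-cocycle groupoid datum is a triple $(\mathcal G,\mathcal N,\pi)$ where $\mathcal N$ is a group bundle over $\mathcal P$ with a right action $\leftharpoonup$ of $\mathcal G$ by group bundle automorphisms, and $\pi:\mathcal G\to\mathcal N$ is a bijection with $p\pi=\mathfrak e$ and $\pi(fg)=(\pi(f)\leftharpoonup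 g)\,\pi(g)$ for composable $f,g$. An isomorphism of data $(\mathcal G,\mathcal N,\pi)\to(\mathcal G,\mathcal N',\pi')$ is an isomorphism of group bundles $\theta:\mathcal N\to\mathcal N'$ over $\mathcal P$ commuting with the actions and with $\pi'=\theta\pi$. *)

(* Defs.v *)
From Stdlib Require Import ProofIrrelevance.
From mathcomp Require Import ssreflect ssrfun ssrbool.

Set Implicit Arguments.
Unset Strict Implicit.
Unset Printing Implicit Defensive.

(* Arrows are composed in diagrammatic order: [mul f g fg] is defined when
   [fg : tgt f = src g].  Partial operations take a proof of definedness as
   their last argument.  In the axioms of this file all these proofs are
   universally quantified; each of them follows from the composability of the
   elements involved and from the source and target axioms, and by proof
   irrelevance its choice is immaterial. *)
Record groupoid (P : Type) := Groupoid {
  arr :> Type;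
  src : arr -> P;
  tgt : arr -> P;
  mul : forall f g : arr, tgt f = src g -> arr;
  idn : P -> arr;
  inv : arr -> arr;
  src_mul : forall f g fg, src (@mul f g fg) = src f;
  tgt_mul : forall f g fg, tgt (@mul f g fg) = tgt g;
  src_idn : forall a, src (idn a) = a;
  tgt_idn : forall a, tgt (idn a) = a;
  src_inv : forall f, src (inv f) = tgt f;
  tgt_inv : forall f, tgt (inv f) = src f;
  mulA : forall f g h (fg : tgt f = src g) (gh : tgt g = src h)
    (f_gh : tgt f = src (mul gh)) (fg_h : tgt (mul fg) = src h),
    mul f_gh = mul fg_h;
  mul1 : forall a f (af : tgt (idn a) = src f), mul af = f;
  mulx1 : forall f a (fa : tgt f = src (idn a)), mul fa = f;
  mulV : forall f (H : tgt (inv f) = src f), mul H = idn (tgt f);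
  mulxV : forall f (H : tgt f = src (inv f)), mul H = idn (src f)
}.

Arguments src {P g0} _.
Arguments tgt {P g0} _.
Arguments mul {P g0} f g _.
Arguments idn {P} g0 _.
Arguments inv {P g0} _.

(* Isomorphism of groupoids over [P], i.e. inducing the identity on [P]. *)
Record groupoid_iso (P : Type) (G H : groupoid P) (phi : G -> H) : Prop :=
  GroupoidIso {
  iso_bij : bijective phi;
  iso_src : forall f, src (phi f) = src f;
  iso_tgt : forall f, tgt (phi f) = tgt f;
  iso_mul : forall f g (fg : tgt f = src g) (H' : tgt (phi f) = src (phi g)),
    phi (mul f g fg) = mul (phi f) (phi g) H'
}.

Definition groupoid_isomorphic (P : Type) (G H : groupoid P) : Prop :=
  exists phi : G -> H, groupoid_iso phi.

Record left_action (P : Type) (G : groupoid P) (E : Type) (p : E -> P) :=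
  LeftAction {
  lact : forall (g : G) (e : E), tgt g = p e -> E;
  p_lact : forall g e ge, p (@lact g e ge) = src g;
  lact_mul : forall g h e (gh : tgt g = src h) (he : tgt h = p e)
    (g_he : tgt g = p (lact he)) (gh_e : tgt (mul g h gh) = p e),
    lact g_he = lact gh_e;
  lact_idn : forall a e (ae : tgt (idn G a) = p e), lact ae = e
}.

Record right_action (P : Type) (G : groupoid P) (E : Type) (p : E -> P) :=
  RightAction {
  ract : forall (e : E) (g : G), p e = src g -> E;
  p_ract : forall e g eg, p (@ract e g eg) = tgt g;
  ract_mul : forall e g h (eg : p e = src g) (gh : tgt g = src h)
    (eg_h : p (ract eg) = src h) (e_gh : p e = src (mul g h gh)),
    ract eg_h = ract e_gh;
  ract_idn : forall e a (ea : p e = src (idn G a)), ract ea = e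
}.

Arguments lact {P G E p} _ g e _.
Arguments ract {P G E p} _ e g _.

Record braided (P : Type) (G : groupoid P) := Braided {
  bl : left_action G (@src P G);
  br : right_action G (@tgt P G);
  braid_src : forall x g xg, tgt (lact bl x g xg) = src (ract br x g xg);
  lact_prod : forall x f g (xf : tgt x = src f) (fg : tgt f = src g)
    (x_fg : tgt x = src (mul f g fg))
    (xf_g : tgt (ract br x f xf) = src g)
    (H : tgt (lact bl x f xf) = src (lact bl (ract br x f xf) g xf_g)),
    lact bl x (mul f g fg) x_fg
      = mul (lact bl x f xf) (lact bl (ract br x f xf) g xf_g) H;
  ract_prod : forall x y g (xy : tgt x = src y) (yg : tgt y = src g)
    (xy_g : tgt (mul x y xy) = src g)
    (x_yg : tgt x = src (lact bl y g yg))
    (H : tgt (ract br x (lact bl y g yg) x_yg) = src (ract br y g yg)),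
    ract br (mul x y xy) g xy_g
      = mul (ract br x (lact bl y g yg) x_yg) (ract br y g yg) H;
  braid_mul : forall f g (fg : tgt f = src g)
    (H : tgt (lact bl f g fg) = src (ract br f g fg)),
    mul f g fg = mul (lact bl f g fg) (ract br f g fg) H
}.

Definition sigma (P : Type) (G : groupoid P) (B : braided G)
    (f g : G) (fg : tgt f = src g) : G * G :=
  (lact (bl B) f g fg, ract (br B) f g fg).

Arguments sigma {P G} B f g fg.

Record group_bundle (P : Type) := GroupBundle {
  bundle_groupoid :> groupoid P;
  bundle_src_tgt : forall n : bundle_groupoid, src n = tgt n
}.

Definition by_automorphisms (P : Type) (G : groupoid P) (N : group_bundle P)
    (A : right_action G (@src P N)) : Prop :=
  forall x y g (xy : tgt x = src y) (xy_g : src (mul x y xy) = src g)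
    (xg : src x = src g) (yg : src y = src g)
    (H : tgt (ract A x g xg) = src (ract A y g yg)),
  ract A (mul x y xy) g xy_g = mul (ract A x g xg) (ract A y g yg) H.

Record cocycle_datum (P : Type) (G : groupoid P) := CocycleDatum {
  datum_bundle : group_bundle P;
  datum_act : right_action G (@src P datum_bundle);
  datum_act_aut : by_automorphisms datum_act;
  pi : G -> datum_bundle;
  piV : datum_bundle -> G;
  piK : cancel pi piV;
  piVK : cancel piV pi;
  src_pi : forall f, src (pi f) = tgt f;
  pi_mul : forall f g (fg : tgt f = src g) (fg' : src (pi f) = src g)
    (H : tgt (ract datum_act (pi f) g fg') = src (pi g)),
    pi (mul f g fg) = mul (ract datum_act (pi f) g fg') (pi g) H
}.

Arguments piV {P G} _ _.

Definition datum_iso (P : Type) (G : groupoid P) (D D' : cocycle_datum G) :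
    Prop :=
  exists theta : datum_bundle D -> datum_bundle D',
    [/\ groupoid_iso theta,
        forall n (g : G) (ng : src n = src g) (ng' : src (theta n) = src g),
          theta (ract (datum_act D) n g ng)
            = ract (datum_act D') (theta n) g ng'
      & forall f, pi D' f = theta (pi D f)].

Section Congruence.
Variables (P : Type) (G : groupoid P).

Lemma mul_eq (f f' g g' : G) (fg : tgt f = src g) (fg' : tgt f' = src g') :
  f = f' -> g = g' -> mul f g fg = mul f' g' fg'.
Proof. by move=> ef eg; subst; rewrite (proof_irrelevance _ fg fg'). Qed.

Lemma lact_eq (E : Type) (p : E -> P) (A : left_action G p) g g' x x'
    (gx : tgt g = p x) (gx' : tgt g' = p x') :
  g = g' -> x = x' -> lact A g x gx = lact A g' x' gx'.
Proof. by move=> eg ex; subst; rewrite (proof_irrelevance _ gx gx'). Qed.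

Lemma ract_eq (E : Type) (p : E -> P) (A : right_action G p) x x' g g'
    (xg : p x = src g) (xg' : p x' = src g') :
  x = x' -> g = g' -> ract A x g xg = ract A x' g' xg'.
Proof. by move=> ex eg; subst; rewrite (proof_irrelevance _ xg xg'). Qed.

Lemma sig_inj (T : Type) (Q : T -> Prop) (u v : sig Q) :
  proj1_sig u = proj1_sig v -> u = v.
Proof.
case: u v => [u Hu] [v Hv] /= uv; subst.
by rewrite (proof_irrelevance _ Hu Hv).
Qed.

Lemma mul_idem (x : G) (xx : tgt x = src x) :
  mul x x xx = x -> x = idn G (src x).
Proof.
move=> e.
have Hl : tgt (inv x) = src x by rewrite tgt_inv.
have Hl' : tgt (inv x) = src (mul x x xx) by rewrite tgt_inv src_mul.
have Hr : tgt (mul (inv x) x Hl) = src x by rewrite tgt_mul.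
have A := mulA Hl' Hr.
have E1 : mul (inv x) (mul x x xx) Hl' = idn G (tgt x).
  by rewrite -(mulV Hl); apply: mul_eq.
have H1 : tgt (idn G (tgt x)) = src x by rewrite tgt_idn.
have E2 : mul (mul (inv x) x Hl) x Hr = x.
  by rewrite -[RHS](mul1 H1); apply: mul_eq => //; rewrite mulV.
by rewrite -{1}E2 -A E1 xx.
Qed.

End Congruence.

Section Bowtie.
Variables (P : Type) (G : groupoid P) (B : braided G).

Definition bowtie_arr := {fy : G * G | tgt fy.1 = src fy.2}.

Implicit Types u v w : bowtie_arr.

Definition bowtie_src u : P := src (proj1_sig u).1.
Definition bowtie_tgt u : P := tgt (proj1_sig u).2.

Lemma bowtie_composable1 u v (uv : bowtie_tgt u = bowtie_src v) :
  tgt (proj1_sig u).1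
    = src (lact (bl B) (proj1_sig u).2 (proj1_sig v).1 uv).
Proof. by rewrite p_lact (proj2_sig u). Qed.

Lemma bowtie_composable2 u v (uv : bowtie_tgt u = bowtie_src v) :
  tgt (ract (br B) (proj1_sig u).2 (proj1_sig v).1 uv)
    = src (proj1_sig v).2.
Proof. by rewrite p_ract (proj2_sig v). Qed.

(* (f, y) (h, z) = (f (y -> h), (y <- h) z) *)
Definition bowtie_pair u v (uv : bowtie_tgt u = bowtie_src v) : G * G :=
  (mul (proj1_sig u).1 (lact (bl B) (proj1_sig u).2 (proj1_sig v).1 uv)
     (bowtie_composable1 uv),
   mul (ract (br B) (proj1_sig u).2 (proj1_sig v).1 uv) (proj1_sig v).2
     (bowtie_composable2 uv)).

Lemma bowtie_pairP u v (uv : bowtie_tgt u = bowtie_src v) :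
  tgt (bowtie_pair uv).1 = src (bowtie_pair uv).2.
Proof. by rewrite /= tgt_mul src_mul braid_src. Qed.

Definition bowtie_mul u v (uv : bowtie_tgt u = bowtie_src v) : bowtie_arr :=
  exist _ (bowtie_pair uv) (bowtie_pairP uv).

Lemma bowtie_idnP a : tgt (idn G a, idn G a).1 = src (idn G a, idn G a).2.
Proof. by rewrite /= tgt_idn src_idn. Qed.

Definition bowtie_idn a : bowtie_arr := exist _ _ (bowtie_idnP a).

Lemma bowtie_inv_composable u :
  tgt (inv (proj1_sig u).2) = src (inv (proj1_sig u).1).
Proof. by rewrite tgt_inv src_inv (proj2_sig u). Qed.

Definition bowtie_inv u : bowtie_arr :=
  exist _ (sigma B _ _ (bowtie_inv_composable u)) (braid_src B _).

Lemma lact_idnr x a (xa : tgt x = src (idn G a)) :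
  lact (bl B) x (idn G a) xa = idn G (src x).
Proof.
have ii : tgt (idn G a) = src (idn G a) by rewrite tgt_idn src_idn.
have x_ii : tgt x = src (mul _ _ ii) by rewrite src_mul.
have xi_i : tgt (ract (br B) x (idn G a) xa) = src (idn G a).
  by rewrite p_ract ii.
have H : tgt (lact (bl B) x (idn G a) xa)
       = src (lact (bl B) (ract (br B) x (idn G a) xa) (idn G a) xi_i).
  by rewrite p_lact braid_src.
have E := lact_prod x_ii H.
have E1 : lact (bl B) x (mul _ _ ii) x_ii = lact (bl B) x (idn G a) xa.
  by apply: lact_eq => //; rewrite mul1.
have E2 : lact (bl B) (ract (br B) x (idn G a) xa) (idn G a) xi_i
        = lact (bl B) x (idn G a) xa.
  by apply: lact_eq => //; rewrite ract_idn.
have xx : tgt (lact (bl B) x (idn G a) xa) = src (lact (bl B) x (idn G a) xa).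
  by rewrite -{2}E2.
rewrite -(p_lact (bl B) xa); apply: (mul_idem (xx := xx)).
by rewrite -{3}E1 E; apply: mul_eq.
Qed.

Lemma ract_idnl a g (ag : tgt (idn G a) = src g) :
  ract (br B) (idn G a) g ag = idn G (tgt g).
Proof.
have ii : tgt (idn G a) = src (idn G a) by rewrite tgt_idn src_idn.
have ii_g : tgt (mul _ _ ii) = src g by rewrite tgt_mul.
have i_ig : tgt (idn G a) = src (lact (bl B) (idn G a) g ag).
  by rewrite p_lact ii.
have H : tgt (ract (br B) (idn G a) (lact (bl B) (idn G a) g ag) i_ig)
       = src (ract (br B) (idn G a) g ag).
  by rewrite p_ract braid_src.
have E := ract_prod ii_g H.
have E1 : ract (br B) (mul _ _ ii) g ii_g = ract (br B) (idn G a) g ag.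
  by apply: ract_eq => //; rewrite mul1.
have E2 : ract (br B) (idn G a) (lact (bl B) (idn G a) g ag) i_ig
        = ract (br B) (idn G a) g ag.
  by apply: ract_eq => //; rewrite lact_idn.
have xx : tgt (ract (br B) (idn G a) g ag) = src (ract (br B) (idn G a) g ag).
  by rewrite -{1}E2.
rewrite -(p_ract (br B) ag) xx; apply: (mul_idem (xx := xx)).
by rewrite -{3}E1 E; apply: mul_eq.
Qed.

Lemma bowtie_src_mul u v uv : bowtie_src (@bowtie_mul u v uv) = bowtie_src u.
Proof. exact: src_mul. Qed.

Lemma bowtie_tgt_mul u v uv : bowtie_tgt (@bowtie_mul u v uv) = bowtie_tgt v.
Proof. exact: tgt_mul. Qed.

Lemma bowtie_src_idn a : bowtie_src (bowtie_idn a) = a.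
Proof. exact: src_idn. Qed.

Lemma bowtie_tgt_idn a : bowtie_tgt (bowtie_idn a) = a.
Proof. exact: tgt_idn. Qed.

Lemma bowtie_src_inv u : bowtie_src (bowtie_inv u) = bowtie_tgt u.
Proof. by rewrite /bowtie_src /= p_lact src_inv. Qed.

Lemma bowtie_tgt_inv u : bowtie_tgt (bowtie_inv u) = bowtie_src u.
Proof. by rewrite /bowtie_tgt /= p_ract tgt_inv. Qed.

Lemma mul_lactA (f y h z k : G) yh zk xz hm fq y_hm f_hm xz_k fq_k :
  mul f (lact (bl B) y (mul h (lact (bl B) z k zk) hm) y_hm) f_hm
    = mul (mul f (lact (bl B) y h yh) fq)
        (lact (bl B) (mul (ract (br B) y h yh) z xz) k xz_k) fq_k.
Proof.
set m := lact _ z k _ in hm y_hm f_hm *.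
set x := ract _ y h _ in xz xz_k fq_k *.
have xm : tgt x = src m by rewrite p_lact.
have q1 : tgt (lact (bl B) y h yh) = src (lact (bl B) x m xm).
  by rewrite p_lact braid_src.
have H2 : tgt f = src (mul _ _ q1) by rewrite src_mul.
have H3 : tgt (mul _ _ fq) = src (lact (bl B) x m xm) by rewrite tgt_mul.
rewrite (mul_eq f_hm H2 erefl (lact_prod y_hm q1)) (mulA H2 H3).
by apply: mul_eq => //; apply: lact_mul.
Qed.

Lemma mul_ractA (y h z k l : G) yh zk xz hm nl y_hm a_nl xz_k b_l :
  mul (ract (br B) y (mul h (lact (bl B) z k zk) hm) y_hm)
      (mul (ract (br B) z k zk) l nl) a_nl
    = mul (ract (br B) (mul (ract (br B) y h yh) z xz) k xz_k) l b_l.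
Proof.
set m := lact _ z k _ in hm y_hm a_nl *.
set x := ract _ y h _ in xz xz_k b_l *.
have xm : tgt x = src m by rewrite p_lact.
have n1 : tgt (ract (br B) x m xm) = src (ract (br B) z k zk).
  by rewrite p_ract braid_src.
have H2 : tgt (mul _ _ n1) = src l by rewrite tgt_mul.
have H3 : tgt (ract (br B) x m xm) = src (mul _ l nl).
  by rewrite src_mul.
rewrite (mul_eq b_l H2 (ract_prod xz_k n1) erefl) -(mulA H3 H2).
by apply: mul_eq => //; rewrite (ract_mul xm y_hm).
Qed.

Lemma bowtie_mulA u v w (uv : bowtie_tgt u = bowtie_src v)
    (vw : bowtie_tgt v = bowtie_src w)
    (u_vw : bowtie_tgt u = bowtie_src (bowtie_mul vw))
    (uv_w : bowtie_tgt (bowtie_mul uv) = bowtie_src w) :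
  bowtie_mul u_vw = bowtie_mul uv_w.
Proof.
apply: sig_inj; rewrite /= /bowtie_pair /=.
by congr (_, _); [apply: mul_lactA | apply: mul_ractA].
Qed.

Lemma bowtie_mul1 a u (au : bowtie_tgt (bowtie_idn a) = bowtie_src u) :
  bowtie_mul au = u.
Proof.
apply: sig_inj; rewrite /= /bowtie_pair /=.
case: u au => [[f y] /= fy] au.
rewrite /bowtie_tgt /bowtie_src /= in au *.
congr (_, _); first by rewrite mul1 lact_idn.
have H : tgt (idn G (src y)) = src y by rewrite tgt_idn.
by rewrite -[RHS](mul1 H); apply: mul_eq => //; rewrite ract_idnl fy.
Qed.

Lemma bowtie_mulx1 u a (ua : bowtie_tgt u = bowtie_src (bowtie_idn a)) :
  bowtie_mul ua = u.
Proof.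
apply: sig_inj; rewrite /= /bowtie_pair /=.
case: u ua => [[f y] /= fy] ua.
rewrite /bowtie_tgt /bowtie_src /= in ua *.
congr (_, _); last by rewrite mulx1 ract_idn.
have H : tgt f = src (idn G (tgt f)) by rewrite src_idn.
by rewrite -[RHS](mulx1 H); apply: mul_eq => //; rewrite lact_idnr fy.
Qed.

Lemma bowtie_mulV u (H : bowtie_tgt (bowtie_inv u) = bowtie_src u) :
  bowtie_mul H = bowtie_idn (bowtie_tgt u).
Proof.
apply: sig_inj; rewrite /= /bowtie_pair /=.
move: H (bowtie_composable1 H) (bowtie_composable2 H).
case: u => [[f y] /= fy]; rewrite /bowtie_tgt /bowtie_src /=.
move: (bowtie_inv_composable _) => /= yf H H1 H2.
have ff : tgt (inv f) = src f by rewrite tgt_inv.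
have y_ff : tgt (inv y) = src (mul _ _ ff) by rewrite src_mul.
have y_i : tgt (inv y) = src (idn G (tgt f)) by rewrite -(mulV ff).
congr (_, _).
  rewrite -(lact_prod y_ff).
  by rewrite (lact_eq (bl B) _ y_i erefl (mulV ff)) lact_idnr src_inv.
have yy : tgt (inv y) = src y by rewrite tgt_inv.
rewrite -(mulV yy); apply: mul_eq => //.
rewrite (ract_mul (gh := ff) H y_ff).
by rewrite (ract_eq (br B) _ y_i erefl (mulV ff)) ract_idn.
Qed.

Lemma bowtie_mulxV u (H : bowtie_tgt u = bowtie_src (bowtie_inv u)) :
  bowtie_mul H = bowtie_idn (bowtie_src u).
Proof.
apply: sig_inj; rewrite /= /bowtie_pair /=.
move: H (bowtie_composable1 H) (bowtie_composable2 H).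
case: u => [[f y] /= fy]; rewrite /bowtie_tgt /bowtie_src /=.
move: (bowtie_inv_composable _) => /= yf H H1 H2.
have yy : tgt y = src (inv y) by rewrite src_inv.
have yy_f : tgt (mul _ _ yy) = src (inv f) by rewrite tgt_mul.
have i_f : tgt (idn G (src y)) = src (inv f) by rewrite -(mulxV yy).
congr (_, _).
  have ff : tgt f = src (inv f) by rewrite src_inv.
  rewrite -(mulxV ff); apply: mul_eq => //.
  rewrite (lact_mul (gh := yy) H yy_f).
  by rewrite (lact_eq (bl B) _ i_f (mulxV yy) erefl) lact_idn.
rewrite -(ract_prod yy_f).
by rewrite (ract_eq (br B) _ i_f (mulxV yy) erefl) ract_idnl tgt_inv.
Qed.

Definition bowtie : groupoid P :=
  Groupoid bowtie_src_mul bowtie_tgt_mul bowtie_src_idn bowtie_tgt_idn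
    bowtie_src_inv bowtie_tgt_inv bowtie_mulA bowtie_mul1 bowtie_mulx1
    bowtie_mulV bowtie_mulxV.

End Bowtie.

Section Semidirect.
Variables (P : Type) (G : groupoid P) (N : group_bundle P).
Variables (A : right_action G (@src P N)) (A_aut : by_automorphisms A).

Definition semidirect_arr := {gn : G * N | tgt gn.1 = src gn.2}.

Implicit Types u v w : semidirect_arr.

Definition semidirect_src u : P := src (proj1_sig u).1.
Definition semidirect_tgt u : P := tgt (proj1_sig u).1.

Lemma semidirect_composable1 u v (uv : semidirect_tgt u = semidirect_src v) :
  src (proj1_sig u).2 = src (proj1_sig v).1.
Proof. by rewrite -(proj2_sig u). Qed.

Lemma semidirect_composable2 u v (uv : semidirect_tgt u = semidirect_src v) :
  tgt (ract A (proj1_sig u).2 (proj1_sig v).1 (semidirect_composable1 uv))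
    = src (proj1_sig v).2.
Proof. by rewrite -bundle_src_tgt p_ract (proj2_sig v). Qed.

(* (g, m) (h, n) = (g h, (m <- h) n) *)
Definition semidirect_pair u v (uv : semidirect_tgt u = semidirect_src v) :
    G * N :=
  (mul (proj1_sig u).1 (proj1_sig v).1 uv,
   mul (ract A (proj1_sig u).2 (proj1_sig v).1 (semidirect_composable1 uv))
     (proj1_sig v).2 (semidirect_composable2 uv)).

Lemma semidirect_pairP u v (uv : semidirect_tgt u = semidirect_src v) :
  tgt (semidirect_pair uv).1 = src (semidirect_pair uv).2.
Proof. by rewrite /= tgt_mul src_mul p_ract. Qed.

Definition semidirect_mul u v (uv : semidirect_tgt u = semidirect_src v) :
    semidirect_arr :=
  exist _ (semidirect_pair uv) (semidirect_pairP uv).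

Lemma semidirect_idnP a : tgt (idn G a, idn N a).1 = src (idn G a, idn N a).2.
Proof. by rewrite /= tgt_idn src_idn. Qed.

Definition semidirect_idn a : semidirect_arr := exist _ _ (semidirect_idnP a).

Lemma semidirect_inv_composable u :
  src (proj1_sig u).2 = src (inv (proj1_sig u).1).
Proof. by rewrite src_inv (proj2_sig u). Qed.

Definition semidirect_inv_pair u : G * N :=
  (inv (proj1_sig u).1,
   inv (ract A (proj1_sig u).2 (inv (proj1_sig u).1)
          (semidirect_inv_composable u))).

Lemma semidirect_invP u :
  tgt (semidirect_inv_pair u).1 = src (semidirect_inv_pair u).2.
Proof. by rewrite /= src_inv -bundle_src_tgt p_ract. Qed.

Definition semidirect_inv u : semidirect_arr := exist _ _ (semidirect_invP u).

Lemma ract_bundle_idn a g (ag : src (idn N a) = src g) :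
  ract A (idn N a) g ag = idn N (tgt g).
Proof.
have ii : tgt (idn N a) = src (idn N a) by rewrite tgt_idn src_idn.
have ii_g : src (mul _ _ ii) = src g by rewrite src_mul.
have xx : tgt (ract A (idn N a) g ag) = src (ract A (idn N a) g ag).
  by rewrite bundle_src_tgt.
rewrite -(p_ract A ag); apply: (mul_idem (xx := xx)).
by rewrite -(A_aut ii_g); apply: ract_eq => //; rewrite mul1.
Qed.

Lemma semidirect_src_mul u v uv :
  semidirect_src (@semidirect_mul u v uv) = semidirect_src u.
Proof. exact: src_mul. Qed.

Lemma semidirect_tgt_mul u v uv :
  semidirect_tgt (@semidirect_mul u v uv) = semidirect_tgt v.
Proof. exact: tgt_mul. Qed.

Lemma semidirect_src_idn a : semidirect_src (semidirect_idn a) = a.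
Proof. exact: src_idn. Qed.

Lemma semidirect_tgt_idn a : semidirect_tgt (semidirect_idn a) = a.
Proof. exact: tgt_idn. Qed.

Lemma semidirect_src_inv u :
  semidirect_src (semidirect_inv u) = semidirect_tgt u.
Proof. exact: src_inv. Qed.

Lemma semidirect_tgt_inv u :
  semidirect_tgt (semidirect_inv u) = semidirect_src u.
Proof. exact: tgt_inv. Qed.

Lemma mul_bundle_ractA (m n k : N) (g h : G) mg nh gh m_gh mg_n mgn_h
    nh_k H1 H2 :
  mul (ract A m (mul g h gh) m_gh) (mul (ract A n h nh) k nh_k) H1
    = mul (ract A (mul (ract A m g mg) n mg_n) h mgn_h) k H2.
Proof.
have mg_h : src (ract A m g mg) = src h by rewrite p_ract.
have H3 : tgt (ract A (ract A m g mg) h mg_h) = src (ract A n h nh).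
  by rewrite -bundle_src_tgt !p_ract.
have H4 : tgt (mul _ _ H3) = src k by rewrite tgt_mul.
have H5 : tgt (ract A (ract A m g mg) h mg_h) = src (mul _ _ nh_k).
  by rewrite src_mul.
rewrite (mul_eq H2 H4 (A_aut mgn_h H3) erefl) -(mulA H5 H4).
by apply: mul_eq => //; rewrite (ract_mul mg_h m_gh).
Qed.

Lemma semidirect_mulA u v w (uv : semidirect_tgt u = semidirect_src v)
    (vw : semidirect_tgt v = semidirect_src w)
    (u_vw : semidirect_tgt u = semidirect_src (semidirect_mul vw))
    (uv_w : semidirect_tgt (semidirect_mul uv) = semidirect_src w) :
  semidirect_mul u_vw = semidirect_mul uv_w.
Proof.
apply: sig_inj; rewrite /= /semidirect_pair /=.
by congr (_, _); [apply: mulA | apply: mul_bundle_ractA].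
Qed.

Lemma semidirect_mul1 a u
    (au : semidirect_tgt (semidirect_idn a) = semidirect_src u) :
  semidirect_mul au = u.
Proof.
apply: sig_inj; rewrite /= /semidirect_pair /=.
move: (semidirect_composable1 au) (semidirect_composable2 au).
case: u au => [[g n] /= gn]; rewrite /semidirect_tgt /= => ag H1 H2.
congr (_, _); first exact: mul1.
have H : tgt (idn N (src n)) = src n by rewrite tgt_idn.
by rewrite -[RHS](mul1 H); apply: mul_eq => //; rewrite ract_bundle_idn gn.
Qed.

Lemma semidirect_mulx1 u a
    (ua : semidirect_tgt u = semidirect_src (semidirect_idn a)) :
  semidirect_mul ua = u.
Proof.
apply: sig_inj; rewrite /= /semidirect_pair /=.
case: u ua => [[g n] /= gn] ua.
by congr (_, _); rewrite mulx1 // ract_idn.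
Qed.

Lemma semidirect_mulV u
    (H : semidirect_tgt (semidirect_inv u) = semidirect_src u) :
  semidirect_mul H = semidirect_idn (semidirect_tgt u).
Proof.
apply: sig_inj; rewrite /= /semidirect_pair /=.
move: (semidirect_composable1 H) (semidirect_composable2 H).
case: u H => [[g n] /= gn]; rewrite /semidirect_tgt /semidirect_src /=.
move: (semidirect_inv_composable _) => /= ng H H1 H2.
congr (_, _); first exact: mulV.
set m := ract A n (inv g) ng in H1 H2 *.
have mg : src m = src g by rewrite p_ract.
have gg : tgt (inv g) = src g by rewrite tgt_inv.
have n_gg : src n = src (mul _ _ gg) by rewrite src_mul src_inv.
have n_i : src n = src (idn G (tgt g)) by rewrite src_idn.
have Em : ract A m g mg = n.
  rewrite (ract_mul mg n_gg).
  by rewrite (ract_eq A _ n_i erefl (mulV gg)) ract_idn.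
have mm : tgt (inv m) = src m by rewrite tgt_inv.
have mm_g : src (mul _ _ mm) = src g by rewrite src_mul.
have H3 : tgt (ract A (inv m) g H1) = src (ract A m g mg).
  by rewrite -bundle_src_tgt !p_ract.
transitivity (mul _ _ H3); first exact: mul_eq.
have i_g : src (idn N (tgt m)) = src g by rewrite -(mulV mm).
rewrite -(A_aut mm_g).
by rewrite (ract_eq A _ i_g (mulV mm) erefl) ract_bundle_idn.
Qed.

Lemma semidirect_mulxV u
    (H : semidirect_tgt u = semidirect_src (semidirect_inv u)) :
  semidirect_mul H = semidirect_idn (semidirect_src u).
Proof.
apply: sig_inj; rewrite /= /semidirect_pair /=.
move: (semidirect_composable1 H) (semidirect_composable2 H).
case: u H => [[g n] /= gn]; rewrite /semidirect_tgt /semidirect_src /=.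
move: (semidirect_inv_composable _) => /= ng H H1 H2.
congr (_, _); first exact: mulxV.
set m := ract A n (inv g) ng in H2 *.
have mm : tgt m = src (inv m) by rewrite src_inv.
transitivity (mul _ _ mm).
  by apply: mul_eq => //; apply: ract_eq.
by rewrite mulxV p_ract tgt_inv.
Qed.

Definition semidirect : groupoid P :=
  Groupoid semidirect_src_mul semidirect_tgt_mul semidirect_src_idn
    semidirect_tgt_idn semidirect_src_inv semidirect_tgt_inv semidirect_mulA
    semidirect_mul1 semidirect_mulx1 semidirect_mulV semidirect_mulxV.

End Semidirect.

Section CocycleDatum.
Variables (P : Type) (G : groupoid P) (D : cocycle_datum G).

Definition datum_semidirect : groupoid P := semidirect (@datum_act_aut P G D).

Lemma pi_composable (f g : G) : tgt f = src g -> src (pi D f) = src g.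
Proof. by rewrite src_pi. Qed.

(* [pi^-1 (pi f <- g)] *)
Definition pi_ract (f g : G) (fg : tgt f = src g) : G :=
  piV D (ract (datum_act D) (pi D f) g (pi_composable fg)).

Lemma pi_ract_composable (f g : G) (fg : tgt f = src g) :
  tgt (mul f g fg) = src (inv (pi_ract fg)).
Proof. by rewrite /pi_ract tgt_mul src_inv -[RHS](src_pi D) piVK p_ract. Qed.

End CocycleDatum.

Arguments pi_ract {P G} D f g fg.
Arguments pi_ract_composable {P G} D {f g} fg.

(* Main.v *)
(* Given a braiding, write [f <| g] and [f |> g] for the two actions.  The
   identity map of [G] becomes a 1-cocycle for [<|] once [G] is made into a
   group bundle by the sum forced by [f g = (f <| g) + g].  Conversely, [pi]
   transports the action on [N] to a right action [<|] of [G] on itself, and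
   [f |> g] is the unique solution of [(f |> g) (f <| g) = f g]; the law for
   [x y <| g] is the cocycle condition, and the laws for [|>] follow by
   cancellation.  The isomorphism of the datum rebuilt from the braiding with
   the original one is [pi], and [(f, y) |-> (f y, pi y)] is the isomorphism
   of the bowtie with the semidirect product. *)

Require Import Defs.
From mathcomp Require Import ssreflect ssrfun ssrbool.
From Stdlib Require Import ProofIrrelevance FunctionalExtensionality.
From Stdlib Require Import ClassicalEpsilon.

Set Implicit Arguments.
Unset Strict Implicit.
Unset Printing Implicit Defensive.

(* Total extensions of the partial operations, with junk values outside the
   domain, so that equations can be rewritten without transporting proofs of
   composability. *)
Section TotalOperations.
Variables (P : Type) (G : groupoid P).

Definition tmul (f g : G) : G :=
  if excluded_middle_informative (tgt f = src g) is left fg then mul f g fg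
  else f.

Definition tlact (E : Type) (p : E -> P) (A : left_action G p)
    (g : G) (e : E) : E :=
  if excluded_middle_informative (tgt g = p e) is left ge then lact A g e ge
  else e.

Definition tract (E : Type) (p : E -> P) (A : right_action G p)
    (e : E) (g : G) : E :=
  if excluded_middle_informative (p e = src g) is left eg then ract A e g eg
  else e.

End TotalOperations.

Local Infix "**" := tmul (at level 40, left associativity).

(** * Groupoid and action laws for the total operations *)

Section TotalGroupoid.
Variables (P : Type) (G : groupoid P).
Implicit Types f g h : G.

Lemma mulE f g fg : mul f g fg = f ** g.
Proof.
by rewrite /tmul; case: excluded_middle_informative => // fg'; apply: mul_eq.
Qed.

Lemma src_tmul f g : src (f ** g) = src f.
Proof.
by rewrite /tmul; case: excluded_middle_informative => // fg; apply: src_mul.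
Qed.

Lemma tgt_tmul f g : tgt f = src g -> tgt (f ** g) = tgt g.
Proof. by move=> fg; rewrite -(mulE fg) tgt_mul. Qed.

Lemma tmulA f g h :
  tgt f = src g -> tgt g = src h -> f ** (g ** h) = f ** g ** h.
Proof.
move=> fg gh; have f_gh : tgt f = src (mul g h gh) by rewrite src_mul.
have fg_h : tgt (mul f g fg) = src h by rewrite tgt_mul.
by have := mulA f_gh fg_h; rewrite !mulE.
Qed.

Lemma tmul1 a f : a = src f -> idn G a ** f = f.
Proof.
move=> af; have H : tgt (idn G a) = src f by rewrite tgt_idn.
by rewrite -(mulE H) mul1.
Qed.

Lemma tmulx1 a f : tgt f = a -> f ** idn G a = f.
Proof.
move=> fa; have H : tgt f = src (idn G a) by rewrite src_idn.
by rewrite -(mulE H) mulx1.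
Qed.

Lemma tmulV f : inv f ** f = idn G (tgt f).
Proof. by rewrite -(mulE (tgt_inv f)) mulV. Qed.

Lemma tmulxV f : f ** inv f = idn G (src f).
Proof. by rewrite -(mulE (esym (src_inv f))) mulxV. Qed.

Lemma tmulK f g : tgt f = src g -> f ** g ** inv g = f.
Proof.
by move=> fg; rewrite -tmulA ?src_inv // tmulxV tmulx1.
Qed.

Lemma tmulVK f g : tgt f = tgt g -> f ** inv g ** g = f.
Proof.
by move=> fg; rewrite -tmulA ?src_inv ?tgt_inv // tmulV tmulx1.
Qed.

Lemma tmulIr f f' g :
  tgt f = src g -> tgt f' = src g -> f ** g = f' ** g -> f = f'.
Proof. by move=> fg f'g e; rewrite -(tmulK fg) e tmulK. Qed.

Lemma inv_unique f g : tgt f = src g -> f ** g = idn G (src f) -> f = inv g.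
Proof.
move=> fg e.
have tg : tgt g = src f by rewrite -(tgt_tmul fg) e tgt_idn.
apply: (@tmulIr _ _ g); rewrite ?tgt_inv // tmulV e.
by rewrite tg.
Qed.

Variables (E : Type) (p : E -> P) (L : left_action G p) (A : right_action G p).

Lemma lactE g e ge : lact L g e ge = tlact L g e.
Proof.
by rewrite /tlact; case: excluded_middle_informative => // *; apply: lact_eq.
Qed.

Lemma p_tlact g e : tgt g = p e -> p (tlact L g e) = src g.
Proof. by move=> ge; rewrite -(lactE ge) p_lact. Qed.

Lemma ractE e g eg : ract A e g eg = tract A e g.
Proof.
by rewrite /tract; case: excluded_middle_informative => // *; apply: ract_eq.
Qed.

Lemma p_tract e g : p e = src g -> p (tract A e g) = tgt g.
Proof. by move=> eg; rewrite -(ractE eg) p_ract. Qed.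

Lemma tract_mul e g h : p e = src g -> tgt g = src h ->
  tract A (tract A e g) h = tract A e (g ** h).
Proof.
move=> eg gh; have eg_h : p (ract A e g eg) = src h by rewrite p_ract.
have e_gh : p e = src (mul g h gh) by rewrite src_mul.
by have := ract_mul eg_h e_gh; rewrite !ractE !mulE.
Qed.

Lemma tract_idn e a : p e = a -> tract A e (idn G a) = e.
Proof.
move=> ea; have H : p e = src (idn G a) by rewrite src_idn.
by rewrite -(ractE H) ract_idn.
Qed.

Lemma tractK e g : p e = src g -> tract A (tract A e g) (inv g) = e.
Proof. by move=> eg; rewrite tract_mul ?src_inv // tmulxV tract_idn. Qed.

Lemma tractVK e g : p e = tgt g -> tract A (tract A e (inv g)) g = e.
Proof.
by move=> eg; rewrite tract_mul ?src_inv ?tgt_inv // tmulV tract_idn.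
Qed.

End TotalGroupoid.

(** Composability survives as side conditions on sources and targets. The rules with premises call
    the tactic recursively on them. *)
Ltac endpoints := solve [repeat first
  [ rewrite src_tmul | rewrite src_inv | rewrite tgt_inv
  | rewrite src_idn | rewrite tgt_idn
  | rewrite tgt_tmul; [|endpoints] | rewrite p_tract; [|endpoints]
  | rewrite p_tlact; [|endpoints] ]; congruence].

(** * From a braiding to a cocycle datum *)

Section Braided.
Variables (P : Type) (G : groupoid P) (B : braided G).
Local Notation "f |> g" := (tlact (bl B) f g) (at level 35).
Local Notation "f <| g" := (tract (br B) f g) (at level 35).
Implicit Types f g x y : G.

Lemma braid_tsrc x g : tgt x = src g -> tgt (x |> g) = src (x <| g).
Proof. by move=> xg; rewrite -(lactE _ xg) -(ractE _ xg) braid_src. Qed.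

Lemma braid_tmul f g : tgt f = src g -> f ** g = (f |> g) ** (f <| g).
Proof.
by move=> fg; rewrite -(mulE fg) (braid_mul (braid_src B fg)) mulE lactE ractE.
Qed.

Lemma tract_prod x y g : tgt x = src y -> tgt y = src g ->
  (x ** y) <| g = (x <| (y |> g)) ** (y <| g).
Proof.
move=> xy yg; have xy_g : tgt (mul x y xy) = src g by rewrite tgt_mul.
have x_yg : tgt x = src (lact (bl B) y g yg) by rewrite p_lact.
have H : tgt (ract (br B) x _ x_yg) = src (ract (br B) y g yg).
  by rewrite p_ract braid_src.
by have := ract_prod xy_g H; rewrite !(mulE, ractE, lactE).
Qed.

Lemma tract_idnl a g : a = src g -> idn G a <| g = idn G (tgt g).
Proof.
move=> ag; have H : tgt (idn G a) = src g by rewrite tgt_idn.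
by rewrite -(ractE _ H) ract_idnl.
Qed.

(* Forced by [f g = (f <| g) + g], the cocycle condition for the identity. *)
Definition badd (m n : G) : G := (m <| inv n) ** n.
(** Solving [badd x n = idn G (tgt n)] gives [x <| inv n = inv n], hence this value of [x]. *)
Definition bopp (n : G) : G := inv n <| n.

Lemma src_badd_arg m n :
  tgt m = tgt n -> tgt (m <| inv n) = src n.
Proof. by move=> mn; rewrite p_tract ?src_inv // tgt_inv. Qed.

Lemma tgt_badd m n : tgt m = tgt n -> tgt (badd m n) = tgt n.
Proof. by move=> mn; rewrite tgt_tmul // src_badd_arg. Qed.

Lemma tgt_bopp n : tgt (bopp n) = tgt n.
Proof. by rewrite p_tract // tgt_inv. Qed.

Lemma badd_tract f g : tgt f = src g -> badd (f <| g) g = f ** g.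
Proof. by move=> fg; rewrite /badd tractK. Qed.

(** The product rule for [<|] leaves the right factor [n <| g] on both sides. On the left factors,
    [m] is acted on by [inv n ** (n |> g)] and by [g ** inv (n <| g)], which agree because
    [n ** g = (n |> g) ** (n <| g)]. *)
Lemma tract_badd m n g : tgt m = tgt n -> tgt n = src g ->
  badd m n <| g = badd (m <| g) (n <| g).
Proof.
move=> mn ng; rewrite /badd tract_prod ?src_badd_arg //; congr (_ ** _).
have lg : tgt (n |> g) = src (n <| g) by rewrite braid_tsrc.
rewrite !tract_mul ?src_inv ?tgt_inv ?p_tlact ?mn ?p_tract //.
congr (_ <| _); apply: (@tmulIr _ _ _ _ (n <| g)).
- by rewrite tgt_tmul ?tgt_inv ?p_tlact.
- by rewrite tgt_tmul ?tgt_inv ?src_inv ?p_tract.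
rewrite tmulVK ?p_tract // -tmulA ?tgt_inv ?p_tlact //.
by rewrite -braid_tmul // tmulA ?tgt_inv // tmulV tmul1.
Qed.

(** With [n = n' <| k] and [m = m' <| (n' ** k)], both sums become the product of [m'], [n'] and
    [k], so associativity is inherited from [G]. *)
Lemma baddA m n k : tgt m = tgt n -> tgt n = tgt k ->
  badd m (badd n k) = badd (badd m n) k.
Proof.
move=> mn nk.
have -> : n = (n <| inv k) <| k by rewrite tractVK.
set n' := n <| inv k; have n'k : tgt n' = src k by endpoints.
have -> : m = (m <| inv (n' ** k)) <| (n' ** k).
  by rewrite tractVK //; endpoints.
set m' := m <| _; have m'n' : tgt m' = src n' by endpoints.
rewrite badd_tract // badd_tract ?src_tmul // -tract_mul //.
by rewrite -tract_badd ?badd_tract ?tmulA //; endpoints.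
Qed.

Lemma badd1 a n : a = tgt n -> badd (idn G a) n = n.
Proof. by move=> an; rewrite /badd tract_idnl ?src_inv // tgt_inv tmul1. Qed.

Lemma baddx1 n a : tgt n = a -> badd n (idn G a) = n.
Proof.
move=> na; rewrite /badd.
have -> : inv (idn G a) = idn G a.
  by rewrite -(@inv_unique _ _ (idn G a)) // ?tmul1; endpoints.
by rewrite tract_idn // tmulx1.
Qed.

Lemma baddV n : badd (bopp n) n = idn G (tgt n).
Proof. by rewrite /badd tractK ?tgt_inv // tmulV. Qed.

(** For [l = inv n |> n], the identity [l ** bopp n = inv n ** n] makes [l] the inverse of [bopp n].
    The product rule for [(n ** inv n) <| n] shows that [n <| l] is that inverse too. *)
Lemma baddxV n : badd n (bopp n) = idn G (tgt n).
Proof.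
set l := inv n |> n.
have src_l : src l = tgt n by rewrite p_tlact ?src_inv ?tgt_inv.
have tgt_l : tgt l = src (bopp n) by rewrite braid_tsrc ?tgt_inv.
have lE : l = inv (bopp n).
  by apply: inv_unique; rewrite // -braid_tmul ?tgt_inv // tmulV src_l.
have nlE : n <| l = inv (bopp n).
  apply: inv_unique; rewrite ?p_tract //.
  rewrite -tract_prod ?src_inv ?tgt_inv // tmulxV tract_idnl //.
  (* The source of [n <| l] is read off its product with [bopp n], which is the identity at
     [tgt n]. *)
  by rewrite -(src_tmul _ (bopp n)) -tract_prod ?src_inv ?tgt_inv //
             tmulxV tract_idnl // src_idn.
by rewrite /badd -lE nlE tmulV tgt_bopp.
Qed.

(** Kept transparent, so that its source map reduces to [tgt] of [G] and [br B] itself is an action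
    on it. *)
Definition braided_groupoid : groupoid P.
Proof.
refine (@Groupoid P G tgt tgt (fun m n _ => badd m n) (idn G) bopp
  _ _ _ _ _ _ _ _ _ _ _).
- by move=> m n mn; rewrite tgt_badd.
- by move=> m n mn; rewrite tgt_badd.
- exact: tgt_idn.
- exact: tgt_idn.
- exact: tgt_bopp.
- exact: tgt_bopp.
- by move=> m n k mn nk _ _; apply: baddA.
- by move=> a n; rewrite tgt_idn; apply: badd1.
- by move=> n a; rewrite tgt_idn; apply: baddx1.
- by move=> n _; apply: baddV.
- by move=> n _; apply: baddxV.
Defined.

Definition braided_bundle : group_bundle P :=
  @GroupBundle P braided_groupoid (fun _ => erefl).

Definition braided_act : right_action G (@src P braided_bundle) := br B.

Lemma braided_act_aut : by_automorphisms braided_act.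
Proof.
move=> m n g /= mn mn_g mg ng _; rewrite !ractE.
exact: tract_badd.
Qed.

Lemma braided_cocycle f g (fg : tgt f = src g)
    (fg' : @src P braided_bundle f = src g)
    (H : tgt (ract braided_act f g fg') = @src P braided_bundle g) :
  mul f g fg = mul (ract braided_act f g fg') (g : braided_bundle) H.
Proof. by rewrite mulE /= ractE; apply/esym/badd_tract. Qed.

Definition datum_of_braided : cocycle_datum G :=
  @CocycleDatum P G braided_bundle braided_act braided_act_aut id id
    (fun _ => erefl) (fun _ => erefl) (fun _ => erefl) braided_cocycle.

End Braided.

(** Apart from the two operations recorded by [sigma], all fields are propositions, so function
    extensionality and proof irrelevance suffice. *)
Lemma braided_ext (P : Type) (G : groupoid P) (B B' : braided G) :
  (forall f g fg, sigma B f g fg = sigma B' f g fg) -> B = B'.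
Proof.
case: B => [[l l1 l2 l3] [r r1 r2 r3] b1 b2 b3 b4].
case: B' => [[l' l1' l2' l3'] [r' r1' r2' r3'] b1' b2' b3' b4'] /= e.
have el : l = l'.
  apply: functional_extensionality_dep => f.
  apply: functional_extensionality_dep => g.
  by apply: functional_extensionality_dep => fg; case: (e f g fg).
have er : r = r'.
  apply: functional_extensionality_dep => f.
  apply: functional_extensionality_dep => g.
  by apply: functional_extensionality_dep => fg; case: (e f g fg).
clear e; subst l' r'.
have e1 := proof_irrelevance _ l1 l1'; have e2 := proof_irrelevance _ r1 r1'.
subst l1' r1'.
have e3 := proof_irrelevance _ l2 l2'; have e4 := proof_irrelevance _ r2 r2'.
have e5 := proof_irrelevance _ l3 l3'; have e6 := proof_irrelevance _ r3 r3'.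
by subst l2' r2' l3' r3'; f_equal; apply: proof_irrelevance.
Qed.

(** * From a cocycle datum to a braiding *)

Section Datum.
Variables (P : Type) (G : groupoid P) (D : cocycle_datum G).
Local Notation N := (datum_bundle D).
Local Notation A := (datum_act D).
Implicit Types f g x y : G.

Lemma src_piV (n : N) : tgt (piV D n) = src n.
Proof. by rewrite -(src_pi D) piVK. Qed.

Lemma tgt_pi f : tgt (pi D f) = tgt f.
Proof. by rewrite -bundle_src_tgt src_pi. Qed.

Lemma pi_tmul f g : tgt f = src g ->
  pi D (f ** g) = tract A (pi D f) g ** pi D g.
Proof.
move=> fg; have fg' : src (pi D f) = src g by rewrite src_pi.
have H : tgt (ract A (pi D f) g fg') = src (pi D g).
  by rewrite -bundle_src_tgt p_ract src_pi.
by rewrite -(mulE fg) (pi_mul fg H) mulE ractE.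
Qed.

Lemma tract_tmul (m n : N) g : src m = src n -> src n = src g ->
  tract A (m ** n) g = tract A m g ** tract A n g.
Proof.
move=> mn ng; have mg : src m = src g by rewrite mn.
have mn' : tgt m = src n by rewrite -bundle_src_tgt.
have mn_g : src (mul m n mn') = src g by rewrite src_mul.
have H : tgt (ract A m g mg) = src (ract A n g ng).
  by rewrite -bundle_src_tgt !p_ract.
by have := datum_act_aut mn_g H; rewrite !(mulE, ractE).
Qed.

(** The cocycle condition for [idn G a ** idn G a] makes the image idempotent, and an idempotent of
    a groupoid is an identity. *)
Lemma pi_idn a : pi D (idn G a) = idn N a.
Proof.
have aE : src (pi D (idn G a)) = a by rewrite src_pi tgt_idn.
have xx : tgt (pi D (idn G a)) = src (pi D (idn G a)) by rewrite bundle_src_tgt.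
rewrite -{2}aE; apply: (mul_idem (xx := xx)); rewrite mulE.
rewrite -{3}(@tmul1 _ _ a (idn G a)) ?src_idn //.
by rewrite pi_tmul ?src_idn ?tgt_idn // tract_idn.
Qed.

Definition piract f g : G := piV D (tract A (pi D f) g).
Definition pilact f g : G := f ** g ** inv (piract f g).
Local Notation "f |> g" := (pilact f g) (at level 35).
Local Notation "f <| g" := (piract f g) (at level 35).

Lemma pi_ractE f g (fg : tgt f = src g) : pi_ract D f g fg = f <| g.
Proof. by rewrite /pi_ract ractE. Qed.

Lemma tgt_piract f g : tgt f = src g -> tgt (f <| g) = tgt g.
Proof. by move=> fg; rewrite src_piV p_tract // src_pi. Qed.

Lemma pi_piract f g : pi D (f <| g) = tract A (pi D f) g.
Proof. exact: piVK. Qed.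

Lemma src_pilact f g : src (f |> g) = src f.
Proof. by rewrite !src_tmul. Qed.

Lemma tgt_pilact f g : tgt f = src g -> tgt (f |> g) = src (f <| g).
Proof.
by move=> fg; rewrite tgt_tmul ?tgt_inv // src_inv tgt_tmul ?tgt_piract.
Qed.

Lemma pilact_piract f g : tgt f = src g -> (f |> g) ** (f <| g) = f ** g.
Proof. by move=> fg; rewrite /pilact tmulVK // tgt_tmul ?tgt_piract. Qed.

(** Right cancellation of [f <| g]. Each law of [|>] below is obtained by checking this equation for
    the proposed value. *)
Lemma pilact_unique f g x : tgt f = src g ->
  tgt x = src (f <| g) -> x ** (f <| g) = f ** g -> x = f |> g.
Proof.
move=> fg xfg e; apply: (@tmulIr _ _ _ _ (f <| g)) => //.
  exact: tgt_pilact.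
by rewrite pilact_piract.
Qed.

Lemma piract_mul x f g : tgt x = src f -> tgt f = src g ->
  (x <| f) <| g = x <| (f ** g).
Proof. by move=> xf fg; rewrite /piract piVK tract_mul // src_pi. Qed.

Lemma piract_idn f a : tgt f = a -> f <| idn G a = f.
Proof. by move=> fa; rewrite /piract tract_idn ?piK // src_pi. Qed.

(** Under [pi] this says that automorphisms preserve identities. *)
Lemma idn_piract g : idn G (src g) <| g = idn G (tgt g).
Proof.
apply: (can_inj (piK D)); rewrite pi_piract !pi_idn.
have ag : src (idn N (src g)) = src g by rewrite src_idn.
by rewrite -(ractE A ag) ract_bundle_idn //; apply: datum_act_aut.
Qed.

(** After applying [pi] and the cocycle condition, both sides have the factor [pi y] acted on by
    [g]. In the other factor [pi x] is acted on by [y ** g] and by [(y |> g) ** (y <| g)], which are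
    equal. *)
Lemma piract_prod x y g : tgt x = src y -> tgt y = src g ->
  (x ** y) <| g = (x <| (y |> g)) ** (y <| g).
Proof.
move=> xy yg; apply: (can_inj (piK D)).
have x_yg : tgt x = src (y |> g) by rewrite src_pilact.
have yg' := tgt_pilact yg.
rewrite pi_tmul ?tgt_piract // !pi_piract pi_tmul // tract_mul ?src_pi //.
rewrite pilact_piract // tract_tmul ?p_tract ?src_pi //.
by rewrite tract_mul // src_pi.
Qed.

(** Multiplied by [(x <| (y |> g)) ** (y <| g)], the left side collapses first to
    [x ** (y |> g) ** (y <| g)], then to [x ** y ** g]. *)
Lemma pilact_mul x y g : tgt x = src y -> tgt y = src g ->
  x |> (y |> g) = (x ** y) |> g.
Proof.
move=> xy yg.
have x_yg : tgt x = src (y |> g) by rewrite src_pilact.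
have yg' := tgt_pilact yg.
have xyg' := tgt_pilact x_yg; have tyg := tgt_piract x_yg.
apply: pilact_unique; rewrite ?piract_prod ?[src (_ ** _)]src_tmul //.
  by rewrite tgt_tmul.
rewrite tmulA ?tyg // pilact_piract // -tmulA //.
by rewrite pilact_piract // tmulA.
Qed.

Lemma pilact_idn g : idn G (src g) |> g = g.
Proof.
apply/esym/pilact_unique; rewrite ?idn_piract ?src_idn ?tgt_idn //.
by rewrite tmul1 // tmulx1.
Qed.

(** Multiplied by [(x <| f) <| g], the right side collapses first to [(x |> f) ** (x <| f) ** g],
    then to [x ** f ** g]. *)
Lemma pilact_prod x f g : tgt x = src f -> tgt f = src g ->
  x |> (f ** g) = (x |> f) ** ((x <| f) |> g).
Proof.
move=> xf fg; have xf_g : tgt (x <| f) = src g by rewrite tgt_piract.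
have H : tgt (x |> f) = src ((x <| f) |> g).
  by rewrite src_pilact tgt_pilact.
have xfg := tgt_pilact xf; have xf_g' := tgt_pilact xf_g.
apply/esym/pilact_unique; rewrite -?piract_mul ?[src (_ ** _)]src_tmul //.
  by rewrite tgt_tmul.
rewrite -tmulA // pilact_piract // tmulA //.
by rewrite pilact_piract // tmulA.
Qed.

Definition datum_lact : left_action G (@src P G).
Proof.
refine (@LeftAction P G G (@src P G) (fun f g _ => f |> g) _ _ _).
- by move=> f g _; apply: src_pilact.
- by move=> f g h fg gh _ _; rewrite mulE; apply: pilact_mul.
- by move=> a g; rewrite tgt_idn => ->; apply: pilact_idn.
Defined.

Definition datum_ract : right_action G (@tgt P G).
Proof.
refine (@RightAction P G G (@tgt P G) (fun f g _ => f <| g) _ _ _).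
- by move=> f g fg; apply: tgt_piract.
- by move=> f g h fg gh _ _; rewrite mulE; apply: piract_mul.
- by move=> f a; rewrite src_idn; apply: piract_idn.
Defined.

Definition braided_of_datum : braided G.
Proof.
refine (@Braided P G datum_lact datum_ract _ _ _ _) => /=.
- by move=> f g; apply: tgt_pilact.
- by move=> x f g xf fg *; rewrite !mulE; apply: pilact_prod.
- by move=> x y g xy yg *; rewrite !mulE; apply: piract_prod.
- by move=> f g fg *; rewrite !mulE pilact_piract.
Defined.

Lemma sigma_braided_of_datum f g fg :
  sigma braided_of_datum f g fg
    = (mul (mul f g fg) (inv (pi_ract D f g fg)) (pi_ract_composable D fg),
       pi_ract D f g fg).
Proof. by rewrite /sigma /= !mulE pi_ractE. Qed.

(** * The bowtie as a semidirect product *)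

Lemma bowtie_to_semidirectP (u : bowtie braided_of_datum) :
  tgt ((proj1_sig u).1 ** (proj1_sig u).2) = src (pi D (proj1_sig u).2).
Proof. by rewrite src_pi tgt_tmul //; case: u. Qed.

Definition bowtie_to_semidirect (u : bowtie braided_of_datum) :
    datum_semidirect D :=
  exist _ ((proj1_sig u).1 ** (proj1_sig u).2, pi D (proj1_sig u).2)
    (bowtie_to_semidirectP u).

Lemma semidirect_to_bowtieP (v : datum_semidirect D) :
  tgt ((proj1_sig v).1 ** inv (piV D (proj1_sig v).2))
    = src (piV D (proj1_sig v).2).
Proof.
by rewrite tgt_tmul ?tgt_inv // src_inv src_piV; case: v.
Qed.

(** Solving [f ** y = g] and [pi D y = n] gives [y = piV D n] and [f = g ** inv y]; the pair is
    inferred from the proof of composability. *)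
Definition semidirect_to_bowtie (v : datum_semidirect D) :
    bowtie braided_of_datum :=
  exist _ (_, _) (semidirect_to_bowtieP v).

Lemma bowtie_semidirect_iso : groupoid_iso bowtie_to_semidirect.
Proof.
split.
- exists semidirect_to_bowtie => [[[f y] /= fy]|[[g n] /= gn]]; apply: sig_inj.
    by rewrite /= piK tmulK.
  by rewrite /= piVK tmulVK // src_piV.
- by move=> [[f y] fy]; apply: src_tmul.
- by move=> [[f y] fy]; apply: tgt_tmul.
move=> [[f y] /= fy] [[h z] /= hz] yh H; apply: sig_inj => /=.
rewrite /semidirect_pair /= !mulE ractE.
rewrite /bowtie_tgt /bowtie_src /= in yh.
have yh' := tgt_pilact yh; have yh_z := tgt_piract yh.
(* The second component is the cocycle condition for [(y <| h) ** z]. *)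
congr (_, _); last first.
  by rewrite pi_tmul ?yh_z // pi_piract tract_mul ?src_pi.
have yhz : tgt (y <| h) = src z by rewrite yh_z.
have f_yh : tgt f = src (y |> h) by rewrite src_pilact.
have fyh : tgt (f ** (y |> h)) = src (y <| h) by rewrite tgt_tmul.
(* In the first component the inner factors [(y |> h) ** (y <| h)] merge into [y ** h]. *)
rewrite tmulA // -(tmulA f_yh) // pilact_piract //.
by rewrite tmulA // -tmulA // tgt_tmul.
Qed.

(** * The two constructions are inverse up to isomorphism *)

Lemma pi_datum_iso : datum_iso (datum_of_braided braided_of_datum) D.
Proof.
exists (pi D); split=> //.
  split.
  - by exists (piV D); [apply: piK | apply: piVK].
  - by move=> f; apply: src_pi.
  - by move=> f; apply: tgt_pi.
  (* [pi] turns the sum into the product of [N]: in the cocycle condition the action of [n] undoes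
     that of [inv n] on [pi D m]. *)
  move=> m n /= mn H; rewrite mulE /badd pi_tmul ?src_badd_arg //=.
  have mn' : @tgt P G m = src (inv (n : G)) by rewrite src_inv.
  by rewrite -(ractE datum_ract mn') pi_piract tractVK // src_pi.
by move=> f g fg fg' /=; rewrite pi_piract ractE.
Qed.

End Datum.

(** With the identity as cocycle, the right action is unchanged, and the left one is recovered by
    cancelling it in [braid_tmul]. *)
Lemma braided_of_datum_of_braided (P : Type) (G : groupoid P) (B : braided G) :
  braided_of_datum (datum_of_braided B) = B.
Proof.
apply: braided_ext => f g fg; rewrite /sigma /=.
have e : f ** g ** inv (tract (br B) f g) = tlact (bl B) f g.
  by rewrite (braid_tmul B fg) tmulK // braid_tsrc.
by congr (_, _); rewrite ?lactE ?ractE.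
Qed.

(** The braiding is determined by [piract], and [theta] commutes with the actions and carries one
    cocycle to the other. *)
Lemma braided_of_datum_iso (P : Type) (G : groupoid P) (D D' : cocycle_datum G) :
  datum_iso D D' -> braided_of_datum D = braided_of_datum D'.
Proof.
case=> theta [iso act piE]; apply: braided_ext => f g fg.
suff e : piract D f g = piract D' f g by rewrite /sigma /= /pilact e.
apply: (can_inj (piK D')); rewrite pi_piract !piE pi_piract.
have ng : src (pi D f) = src g by rewrite src_pi.
have ng' : src (theta (pi D f)) = src g by rewrite (iso_src iso).
by rewrite -(ractE _ ng) (act _ _ _ ng') ractE.
Qed.

(** The first three clauses say that [Psi] descends to isomorphism classes of data and is there a
    two-sided inverse of [Phi]. The last two cover every braiding [B], as [B = Psi (Phi B)]. *)
Theorem theorem2p14 (P : Type) (P_nonempty : inhabited P) (G : groupoid P) :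
  exists (Phi : braided G -> cocycle_datum G)
         (Psi : cocycle_datum G -> braided G),
    [/\ forall B : braided G, Psi (Phi B) = B,
        forall D : cocycle_datum G, datum_iso (Phi (Psi D)) D,
        forall D D' : cocycle_datum G, datum_iso D D' -> Psi D = Psi D',
        forall D : cocycle_datum G,
          groupoid_isomorphic (bowtie (Psi D)) (datum_semidirect D)
      & forall (D : cocycle_datum G) (f g : G) (fg : tgt f = src g),
          sigma (Psi D) f g fg
            = (mul (mul f g fg) (inv (pi_ract D f g fg))
                 (pi_ract_composable D fg),
               pi_ract D f g fg)].
Proof.
exists (@datum_of_braided P G), (@braided_of_datum P G); split.
- exact: braided_of_datum_of_braided.
- exact: pi_datum_iso.
- exact: braided_of_datum_iso.
- by move=> D; exists (@bowtie_to_semidirect P G D);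
     apply: bowtie_semidirect_iso.
- exact: sigma_braided_of_datum.
Qed.
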